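(* Let $d=2$ and consider on $H'_0$ the equation $$\frac{du_k}{dt}=-i\sum_{k_1\neq 0}(u_{k_1}|k)\,\Pi_k u_{k-k_1}-\nu|k|^2u_k+\Pi_k f_k(t),\qquad k\in\mathbb{Z}^2\setminus\{0\},$$ with $\nu>0$. Assume $f(t,\cdot)\in C^\infty$ uniformly with respect to $t\in\mathbb{R}$. Let $V^*=\nu^{-2}\sup_{t}V(f(t))$ and $V_0>V^*$. Then there exists a sequence of absorbing sets $\mathcal{A}_i$, $i\ge2$, for all symmetric Galerkin projections of the equation, and constants $C_i$, such that $$\mathcal{A}_i\subset\Big\{u\in H'_0:\ V(u)\le V_0,\ |u_k|\le\frac{C_i}{|k|^{\frac i2+1}}\ \forall k\ne0\Big\}.$$ Moreover, for every $s\in\mathbb{N}$ with $s\ge2$ there exists $C_s$ such that $$\mathcal{W}(V_0,s,C_s)=\{u\in H'_0: V(u)\le V_0,\ |u_k|\le C_s/|k|^s\ \forall k\neq0\}$$ is an absorbing set for all symmetric Galerkin projections of the equation.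
   Context: $(a|b)=\sum_i a_i\overline{b_i}$. $H=\ell_2(\mathbb{Z}^2,\mathbb{C}^2)$ is viewed as a real vector space. $H'=\{u\in H: u_{-k}=\overline{u_k},\ (u_k,k)=\sum_i(u_k)_ik_i=0\ \forall k\}$ and $H'_0=H'\cap\{u_0=0\}$. $\Pi_k$ is the orthogonal projection onto the orthogonal complement of $k$ in $\mathbb{C}^2$. The forcing $f(t,x)=\sum_kf_k(t)e^{i(k,x)}$ is real-valued with $f_0\equiv0$. ''$f(t,\cdot)\in C^\infty$ uniformly in $t$'' means $\sup_{t,k\ne0}|k|^\gamma|f_k(t)|<\infty$ for every $\gamma>0$. $V(u)=\sum_k|k|^2|u_k|^2$ is the enstrophy. $P_n$ is defined by $(P_nu)_k=u_k$ for $|k|\le n$ and $0$ otherwise. The symmetric Galerkin projections are the ODEs on $P_nH'_0$ consisting of the equations for $|k|\le n$ with $u=P_nu$. A set $\mathcal{A}$ is absorbing for a system if every trajectory of that system enters $\mathcal{A}$ after a finite time. *)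

(* Defs.v *)
From Stdlib Require Import Reals ZArith List Lra.
From Coquelicot Require Import Coquelicot.
Open Scope R_scope.

Definition wv := (Z * Z)%type.
Definition C2 := (C * C)%type.
Definition state := wv -> C2.
Definition C2zero : C2 := (RtoC 0, RtoC 0).

Definition v_add (a b : C2) : C2 := (Cplus (fst a) (fst b), Cplus (snd a) (snd b)).
Definition v_scal (c : C) (a : C2) : C2 := (Cmult c (fst a), Cmult c (snd a)).
Definition v_conj (a : C2) : C2 := (Cconj (fst a), Cconj (snd a)).
Definition v_norm (a : C2) : R := sqrt (Cmod (fst a) ^ 2 + Cmod (snd a) ^ 2).

Definition wv_neg (k : wv) : wv := (- fst k, - snd k)%Z.
Definition wv_sub (k l : wv) : wv := (fst k - fst l, snd k - snd l)%Z.
Definition wv_is0 (k : wv) : bool := (Z.eqb (fst k) 0 && Z.eqb (snd k) 0)%bool.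

Definition knormsq (k : wv) : R := IZR (fst k) ^ 2 + IZR (snd k) ^ 2.
Definition knorm (k : wv) : R := sqrt (knormsq k).

(** (a | k) = sum_i a_i * conj(k_i) = sum_i a_i k_i since k is real *)
Definition dotk (a : C2) (k : wv) : C :=
  Cplus (Cmult (fst a) (RtoC (IZR (fst k)))) (Cmult (snd a) (RtoC (IZR (snd k)))).

Definition Pi (k : wv) (a : C2) : C2 :=
  v_add a (v_scal (Copp (Cdiv (dotk a k) (RtoC (knormsq k))))
                  (RtoC (IZR (fst k)), RtoC (IZR (snd k)))).

Definition zrange (N : nat) : list Z :=
  map (fun m => (Z.of_nat m - Z.of_nat N)%Z) (seq 0 (2 * N + 1)).
Definition box (N : nat) : list wv := list_prod (zrange N) (zrange N).
Definition ball (n : nat) : list wv :=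
  filter (fun k => Z.leb (fst k * fst k + snd k * snd k) (Z.of_nat n * Z.of_nat n)) (box n).
Definition in_ballb (n : nat) (k : wv) : bool :=
  Z.leb (fst k * fst k + snd k * snd k) (Z.of_nat n * Z.of_nat n).

Definition sumR (l : list wv) (g : wv -> R) : R := fold_right (fun k acc => g k + acc) 0 l.
Definition sumC2 (l : list wv) (g : wv -> C2) : C2 :=
  fold_right (fun k acc => v_add (g k) acc) C2zero l.

(** Enstrophy V(u) = sum_k |k|^2 |u_k|^2 (sum of a nonnegative family, as an
    extended real: limit of the increasing partial sums over boxes). *)
Definition Venst (u : state) : Rbar :=
  Lim_seq (fun N => sumR (box N) (fun k => knormsq k * v_norm (u k) ^ 2)).
Definition l2sq (u : state) : Rbar :=
  Lim_seq (fun N => sumR (box N) (fun k => v_norm (u k) ^ 2)).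

Definition inH' (u : state) : Prop :=
  is_finite (l2sq u) /\
  (forall k, u (wv_neg k) = v_conj (u k)) /\
  (forall k, dotk (u k) k = RtoC 0).
Definition inH'0 (u : state) : Prop := inH' u /\ u (0%Z, 0%Z) = C2zero.

Definition inPnH'0 (n : nat) (u : state) : Prop :=
  inH'0 u /\ forall k, in_ballb n k = false -> u k = C2zero.

(** forcing hypotheses: real valued, zero mean, C^infty uniformly in t *)
Definition forcing_ok (f : R -> state) : Prop :=
  (forall t k, f t (wv_neg k) = v_conj (f t k)) /\
  (forall t, f t (0%Z, 0%Z) = C2zero) /\
  (forall gamma, 0 < gamma -> exists M, forall t k, wv_is0 k = false ->
      Rpower (knorm k) gamma * v_norm (f t k) <= M).

Definition Vstar (nu : R) (f : R -> state) : Rbar :=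
  Rbar_mult (Finite (/ (nu ^ 2))) (Rbar_lub (fun x => exists t, x = Venst (f t))).

(** right hand side of the n-th symmetric Galerkin projection, for |k| <= n, k <> 0:
    -i sum_{k1<>0} (u_{k1}|k) Pi_k u_{k-k1} - nu |k|^2 u_k + Pi_k f_k(t),
    where u = P_n u so k1 ranges over 0 < |k1| <= n. *)
Definition galerkin_rhs (n : nat) (nu : R) (f : R -> state) (t : R) (u : state) (k : wv) : C2 :=
  v_add (v_scal (Copp Ci)
           (sumC2 (filter (fun k1 => negb (wv_is0 k1)) (ball n))
                  (fun k1 => v_scal (dotk (u k1) k) (Pi k (u (wv_sub k k1))))))
   (v_add (v_scal (RtoC (- nu * knormsq k)) (u k)) (Pi k (f t k))).

Definition galerkin_traj (n : nat) (nu : R) (f : R -> state) (t0 : R) (u : R -> state) : Prop :=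
  forall t, t0 < t ->
    inPnH'0 n (u t) /\
    forall k, in_ballb n k = true -> wv_is0 k = false ->
      is_derive (fun s => fst (u s k)) t (fst (galerkin_rhs n nu f t (u t) k)) /\
      is_derive (fun s => snd (u s k)) t (snd (galerkin_rhs n nu f t (u t) k)).

Definition absorbing (n : nat) (nu : R) (f : R -> state) (A : state -> Prop) : Prop :=
  forall t0 u, galerkin_traj n nu f t0 u -> exists T, t0 < T /\ A (u T).

Definition absorbing_all_galerkin nu f A : Prop := forall n, absorbing n nu f A.

Definition W (V0 : R) (s : nat) (Cs : R) (u : state) : Prop :=
  inH'0 u /\ Rbar_le (Venst u) (Finite V0) /\
  forall k, wv_is0 k = false -> v_norm (u k) <= Cs / knorm k ^ s.

(* Main.v *)
Require Import Defs.
From Stdlib Require Import Reals ZArith List Lra Lia ClassicalEpsilon.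
From Coquelicot Require Import Coquelicot.
Open Scope R_scope.

(** The enstrophy of every Galerkin solution obeys [V' <= -nu V + sup V(f) / nu], because in
    two dimensions the nonlinear term conserves enstrophy; hence [V <= V0] from some time on.
    With [q = |k|^(1/2)], the sum [sum |u_k| / q] is then bounded by Cauchy-Schwarz, since
    [sum |k|^-3] converges on the lattice.  If moreover [|u_k| <= c / q^m] from some time on,
    then in each term of the convolution one of the two wave vectors has length at least
    [|k| / 2], and the nonlinear term is [O(|k| / q^(m-1))]; dividing by the dissipation rate
    [nu |k|^2] yields [|u_k| <= c' / q^(m+1)] from some later time on, with [c'] independent
    of the solution and of the projection.  Starting from [|u_k| <= V0^(1/2) / |k|], this
    reaches every power of [|k|], and the sets [W V0 i C_i] can serve as [A_i]. *)

(** * Finite sums over lists of wave vectors *)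

Lemma wv_eq_dec (k l : wv) : {k = l} + {k <> l}.
Proof. decide equality; apply Z.eq_dec. Qed.

Lemma sumR_ext l g h : (forall k, In k l -> g k = h k) -> sumR l g = sumR l h.
Proof.
  induction l as [|a l IH]; simpl; intros H; [reflexivity|].
  rewrite (H a), IH; auto.
Qed.

Lemma sumR_le l g h : (forall k, In k l -> g k <= h k) -> sumR l g <= sumR l h.
Proof.
  induction l as [|a l IH]; simpl; intros H; [lra|].
  apply Rplus_le_compat; auto.
Qed.

Lemma sumR_0 l g : (forall k, In k l -> g k = 0) -> sumR l g = 0.
Proof.
  induction l as [|a l IH]; simpl; intros H; [reflexivity|].
  rewrite (H a), IH; auto; lra.
Qed.

Lemma sumR_nonneg l g : (forall k, In k l -> 0 <= g k) -> 0 <= sumR l g.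
Proof. intros H. rewrite <- (sumR_0 l (fun _ => 0)); auto. now apply sumR_le. Qed.

Lemma sumR_plus l g h : sumR l (fun k => g k + h k) = sumR l g + sumR l h.
Proof. induction l as [|a l IH]; simpl; [lra|]. rewrite IH; lra. Qed.

Lemma sumR_scal l c g : sumR l (fun k => c * g k) = c * sumR l g.
Proof. induction l as [|a l IH]; simpl; [lra|]. rewrite IH; lra. Qed.

Lemma sumR_opp l g : sumR l (fun k => - g k) = - sumR l g.
Proof. induction l as [|a l IH]; simpl; [lra|]. rewrite IH; lra. Qed.

Lemma sumR_app l1 l2 g : sumR (l1 ++ l2) g = sumR l1 g + sumR l2 g.
Proof. induction l1 as [|a l IH]; simpl; [lra|]. rewrite IH; lra. Qed.

Lemma sumR_map (i : wv -> wv) l g : sumR (map i l) g = sumR l (fun k => g (i k)).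
Proof. induction l as [|a l IH]; simpl; [reflexivity|]. now rewrite IH. Qed.

Lemma sumR_exchange l1 l2 (g : wv -> wv -> R) :
  sumR l1 (fun k => sumR l2 (g k)) = sumR l2 (fun p => sumR l1 (fun k => g k p)).
Proof.
  induction l1 as [|a l IH]; simpl.
  - now rewrite sumR_0.
  - now rewrite IH, sumR_plus.
Qed.

Lemma Rabs_sumR l g : Rabs (sumR l g) <= sumR l (fun k => Rabs (g k)).
Proof.
  induction l as [|a l IH]; simpl; [rewrite Rabs_R0; lra|].
  eapply Rle_trans; [apply Rabs_triang|lra].
Qed.

Lemma sumR_ge_term l g k : (forall k, In k l -> 0 <= g k) -> In k l -> g k <= sumR l g.
Proof.
  induction l as [|a l IH]; simpl; intros H Hk; [easy|].
  assert (0 <= sumR l g) by (apply sumR_nonneg; auto).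
  assert (0 <= g a) by auto.
  destruct Hk as [->|Hk]; [lra|].
  assert (g k <= sumR l g) by auto; lra.
Qed.

(** Duplicate-free lists serve as finite index sets; only entries where [h] does not vanish matter,
    so the summation range may change freely outside the support. *)
Lemma sumR_eq_support l l' h : NoDup l -> NoDup l' ->
  (forall k, h k <> 0 -> In k l <-> In k l') -> sumR l h = sumR l' h.
Proof.
  revert l'; induction l as [|a l IH]; simpl; intros l' Hl Hl' H.
  - symmetry; apply sumR_0. intros k Hk.
    destruct (Req_dec (h k) 0) as [E|E]; [exact E|]. now apply (H k E) in Hk.
  - inversion_clear Hl as [|? ? Ha Hl0].
    destruct (Req_dec (h a) 0) as [E|E].
    + rewrite E, Rplus_0_l. apply IH; auto.
      intros k Hk. rewrite <- (H k Hk). split; auto.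
      intros [->|]; [contradiction|assumption].
    + destruct (in_split a l') as (l1 & l2 & ->); [now apply (H a E); left|].
      apply NoDup_remove in Hl'. destruct Hl' as [Hl' Ha'].
      rewrite sumR_app; simpl. rewrite (IH (l1 ++ l2)), sumR_app; auto; [lra|].
      intros k Hk. specialize (H k Hk). rewrite in_app_iff in *. simpl in H.
      split.
      * intros Hkl. assert (k <> a) by (intros ->; contradiction). intuition congruence.
      * intros Hkl. assert (k <> a) by (intros ->; contradiction). intuition congruence.
Qed.

Lemma sumR_le_support l l' h : NoDup l -> NoDup l' -> (forall k, 0 <= h k) ->
  (forall k, In k l -> h k <> 0 -> In k l') -> sumR l h <= sumR l' h.
Proof.
  revert l'; induction l as [|a l IH]; simpl; intros l' Hl Hl' Hh H.
  - now apply sumR_nonneg.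
  - inversion_clear Hl as [|? ? Ha Hl0].
    destruct (Req_dec (h a) 0) as [E|E].
    + rewrite E, Rplus_0_l. apply IH; auto.
    + destruct (in_split a l') as (l1 & l2 & ->); [now apply H; auto|].
      apply NoDup_remove in Hl'. destruct Hl' as [Hl' Ha'].
      rewrite sumR_app; simpl.
      assert (sumR l h <= sumR (l1 ++ l2) h).
      { apply IH; auto. intros k Hk Hk0.
        assert (k <> a) by (intros ->; contradiction).
        specialize (H k (or_intror Hk) Hk0). rewrite in_app_iff in *. simpl in H.
        intuition congruence. }
      rewrite sumR_app in H0; lra.
Qed.

(** Reindexing by the involution [i] shows that the sum equals its own negative. Only the support of
    [h] has to lie in [l], since a ball of wave vectors is not stable under reflections such as
    [p -> k - p]. *)
Lemma sumR_antisym (i : wv -> wv) l h : (forall k, i (i k) = k) -> NoDup l ->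
  (forall k, h (i k) = - h k) -> (forall k, h k <> 0 -> In k l) -> sumR l h = 0.
Proof.
  intros Hi Hl Ha Hs.
  assert (Hm : NoDup (map i l)).
  { apply NoDup_map_NoDup_ForallPairs; auto.
    intros x y _ _ E. now rewrite <- (Hi x), E, Hi. }
  assert (E : sumR l h = sumR (map i l) h).
  { apply sumR_eq_support; auto. intros k Hk. split; intros _; auto.
    rewrite <- (Hi k). apply in_map, Hs. rewrite Ha. lra. }
  rewrite sumR_map, (sumR_ext l (fun k => h (i k)) (fun k => - h k)), sumR_opp in E; auto. lra.
Qed.

(** * Boxes and balls of wave vectors *)

Lemma In_zrange N x : In x (zrange N) <-> (- Z.of_nat N <= x <= Z.of_nat N)%Z.
Proof.
  unfold zrange. rewrite in_map_iff. split.
  - intros (m & <- & Hm). apply in_seq in Hm. lia.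
  - intros H. exists (Z.to_nat (x + Z.of_nat N)). split; [lia|]. apply in_seq. lia.
Qed.

Lemma NoDup_zrange N : NoDup (zrange N).
Proof.
  apply NoDup_map_NoDup_ForallPairs; [|apply seq_NoDup].
  intros x y _ _ E. lia.
Qed.

Lemma NoDup_list_prod {A B : Type} (l : list A) (l' : list B) :
  NoDup l -> NoDup l' -> NoDup (list_prod l l').
Proof.
  intros Hl Hl'. induction Hl as [|a l Ha Hl IH]; simpl; [constructor|].
  apply NoDup_app; auto.
  - apply NoDup_map_NoDup_ForallPairs; auto. intros x y _ _ E; now inversion E.
  - intros [x y] H1 H2. apply in_map_iff in H1. destruct H1 as (z & E & _).
    inversion E; subst. now apply in_prod_iff in H2.
Qed.

Lemma NoDup_box N : NoDup (box N).
Proof. apply NoDup_list_prod; apply NoDup_zrange. Qed.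

Lemma In_box_mono N k : In k (box N) -> In k (box (S N)).
Proof.
  destruct k as [x y]. unfold box, wv. rewrite !in_prod_iff, !In_zrange. lia.
Qed.

(** The summation range of the nonlinear term in [galerkin_rhs], and also the list of modes governed
    by the truncated equations. *)
Definition punctured_ball (n : nat) : list wv :=
  filter (fun k => negb (wv_is0 k)) (Defs.ball n).

Lemma wv_is0_true k : wv_is0 k = true <-> k = (0, 0)%Z.
Proof.
  destruct k as [x y]; unfold wv_is0; simpl.
  rewrite Bool.andb_true_iff, !Z.eqb_eq. split; [now intros [-> ->]|now intros [= -> ->]].
Qed.

Lemma In_punctured_ball n k :
  In k (punctured_ball n) <-> in_ballb n k = true /\ wv_is0 k = false.
Proof.
  unfold punctured_ball, Defs.ball. rewrite !filter_In, Bool.negb_true_iff.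
  fold (in_ballb n k). split; [tauto|]. intros [H1 H2]. repeat split; auto.
  destruct k as [x y]. unfold in_ballb in H1; simpl in H1. apply Z.leb_le in H1.
  unfold box, wv. rewrite in_prod_iff, !In_zrange. nia.
Qed.

Lemma NoDup_punctured_ball n : NoDup (punctured_ball n).
Proof. apply NoDup_filter, NoDup_filter, NoDup_box. Qed.

Lemma In_punctured_ball_box n k : In k (punctured_ball n) -> In k (box n).
Proof. unfold punctured_ball, Defs.ball. now rewrite !filter_In. Qed.

Lemma knormsq_ge1 k : wv_is0 k = false -> 1 <= knormsq k.
Proof.
  destruct k as [x y]; unfold knormsq; simpl. intros H.
  assert (1 <= x * x + y * y)%Z.
  { apply Bool.andb_false_iff in H. rewrite !Z.eqb_neq in H. simpl in H. nia. }
  apply IZR_le in H0. rewrite plus_IZR, !mult_IZR in H0. lra.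
Qed.

Lemma knormsq_nonneg k : 0 <= knormsq k.
Proof. unfold knormsq. nra. Qed.

Lemma knorm_nonneg k : 0 <= knorm k.
Proof. apply sqrt_pos. Qed.

Lemma knorm_sq k : knorm k ^ 2 = knormsq k.
Proof. apply pow2_sqrt, knormsq_nonneg. Qed.

Lemma knorm_ge1 k : wv_is0 k = false -> 1 <= knorm k.
Proof.
  intros H. apply knormsq_ge1 in H. rewrite <- sqrt_1. now apply sqrt_le_1_alt.
Qed.

Lemma le_of_sq_le a b : 0 <= b -> a ^ 2 <= b ^ 2 -> a <= b.
Proof. intros Hb H. destruct (Rle_lt_dec a b); [assumption|nra]. Qed.

Lemma knorm_triang k p : knorm k <= knorm p + knorm (wv_sub k p).
Proof.
  assert (H1 := knorm_nonneg p). assert (H2 := knorm_nonneg (wv_sub k p)).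
  apply le_of_sq_le; [lra|].
  assert (E1 := knorm_sq p). assert (E2 := knorm_sq (wv_sub k p)).
  rewrite knorm_sq. set (A := knorm p) in *. set (B := knorm (wv_sub k p)) in *.
  unfold knormsq, wv_sub in *; simpl fst in *; simpl snd in *.
  rewrite !minus_IZR in E2.
  set (x := IZR (fst k)) in *. set (y := IZR (snd k)) in *.
  set (a := IZR (fst p)) in *. set (b := IZR (snd p)) in *.
  assert (a * (x - a) + b * (y - b) <= A * B).
  { apply le_of_sq_le; [nra|].
    replace ((A * B) ^ 2) with (A ^ 2 * B ^ 2) by ring. rewrite E1, E2.
    (* Lagrange's identity: this square is the defect in the Cauchy-Schwarz inequality for [p] and
       [k - p]. *)
    assert (0 <= (a * (y - b) - b * (x - a)) ^ 2) by apply pow2_ge_0. nra. }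
  nra.
Qed.

(** * A lattice sum *)

(** Each bootstrap step gains a factor [|k|^(1/2)]; working with this square root keeps all
    exponents natural numbers. *)
Definition qnorm (k : wv) : R := sqrt (knorm k).

Lemma qnorm_sq k : qnorm k ^ 2 = knorm k.
Proof. apply pow2_sqrt, knorm_nonneg. Qed.

Lemma qnorm_nonneg k : 0 <= qnorm k.
Proof. apply sqrt_pos. Qed.

Lemma qnorm_ge1 k : wv_is0 k = false -> 1 <= qnorm k.
Proof. intros H. apply knorm_ge1 in H. rewrite <- sqrt_1. now apply sqrt_le_1_alt. Qed.

Definition sumZ (l : list Z) (g : Z -> R) : R := fold_right (fun x acc => g x + acc) 0 l.

Lemma sumZ_app l1 l2 g : sumZ (l1 ++ l2) g = sumZ l1 g + sumZ l2 g.
Proof. induction l1 as [|a l IH]; simpl; [lra|]. rewrite IH; lra. Qed.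

Lemma sumZ_nonneg l g : (forall x, 0 <= g x) -> 0 <= sumZ l g.
Proof. intros H; induction l as [|a l IH]; simpl; [lra|]. specialize (H a); lra. Qed.

Lemma sumR_list_prod l1 l2 (g h : Z -> R) :
  sumR (list_prod l1 l2) (fun k => g (fst k) * h (snd k)) = sumZ l1 g * sumZ l2 h.
Proof.
  induction l1 as [|a l IH]; simpl; [lra|].
  rewrite sumR_app, IH.
  replace (sumR (map (fun y => (a, y)) l2) (fun k => g (fst k) * h (snd k)))
    with (g a * sumZ l2 h); [lra|].
  clear. induction l2 as [|b l IH]; simpl; [lra|]. rewrite <- IH; lra.
Qed.

Lemma zrange_S N :
  zrange (S N) = (- Z.of_nat (S N))%Z :: zrange N ++ (Z.of_nat (S N) :: nil).
Proof.
  unfold zrange. replace (2 * S N + 1)%nat with (S ((2 * N + 1) + 1)) by lia.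
  rewrite <- cons_seq, seq_app, map_cons, map_app, <- seq_shift, map_map.
  apply f_equal2; [lia|]. apply f_equal2.
  - apply map_ext. intros m. lia.
  - cbn [seq map]. f_equal. lia.
Qed.

(** The weight [|x|^(-3/2)], with [|x|] replaced by 1 at the origin. *)
Definition zweight (x : Z) : R := / sqrt (Rmax 1 (Rabs (IZR x))) ^ 3.

Lemma zweight_pos x : 0 < zweight x.
Proof.
  apply Rinv_0_lt_compat, pow_lt, sqrt_lt_R0. assert (H := Rmax_l 1 (Rabs (IZR x))). lra.
Qed.

(* [a^(-3/2)] is dominated by the telescoping difference of [4 a^(-1/2)]. *)
Lemma zweight_telescope a : 1 <= a ->
  / sqrt a ^ 3 <= 4 * (/ sqrt a - / sqrt (a + 1)).
Proof.
  intros Ha.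
  assert (Hx := sqrt_sqrt a ltac:(lra)). assert (Hy := sqrt_sqrt (a + 1) ltac:(lra)).
  assert (0 < sqrt a) by (apply sqrt_lt_R0; lra).
  assert (0 < sqrt (a + 1)) by (apply sqrt_lt_R0; lra).
  set (x := sqrt a) in *. set (y := sqrt (a + 1)) in *.
  assert (x <= y) by nra.
  assert (y * (y + x) <= 4 * x ^ 2) by nra.
  assert (E : (y - x) * (y + x) = 1) by nra.
  assert (0 <= 4 * x ^ 2 * (y - x) - y).
  { apply Rmult_le_reg_r with (y + x); [lra|].
    replace ((4 * x ^ 2 * (y - x) - y) * (y + x))
      with (4 * x ^ 2 * ((y - x) * (y + x)) - y * (y + x)) by ring.
    rewrite E. lra. }
  apply Rminus_le.
  replace (/ x ^ 3 - 4 * (/ x - / y)) with (- ((4 * x ^ 2 * (y - x) - y) / (x ^ 3 * y)))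
    by (field; lra).
  assert (0 <= (4 * x ^ 2 * (y - x) - y) / (x ^ 3 * y)); [|lra].
  apply Rdiv_le_0_compat; [assumption|]. apply Rmult_lt_0_compat; [apply pow_lt|]; lra.
Qed.

(** Passing from [N] to [S N] adds two end points, each bounded by a telescoping difference; the
    term [8 / sqrt (INR N + 1)] absorbs them, and 9 is the value at [N = 0]. *)
Lemma sumZ_zweight N : sumZ (zrange N) zweight + 8 / sqrt (INR N + 1) <= 9.
Proof.
  induction N as [|N IH].
  - simpl. unfold zweight. simpl. rewrite Rplus_0_l, Rabs_R0, Rmax_left, sqrt_1; lra.
  - rewrite zrange_S. simpl sumZ. rewrite sumZ_app. simpl sumZ.
    assert (Ha : 1 <= INR N + 1) by (assert (H := pos_INR N); lra).
    assert (E : forall x, Rabs (IZR x) = INR N + 1 -> zweight x = / sqrt (INR N + 1) ^ 3).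
    { intros x Hx. unfold zweight. now rewrite Hx, Rmax_right. }
    assert (EN : IZR (Z.of_nat (S N)) = INR N + 1).
    { rewrite <- INR_IZR_INZ. apply S_INR. }
    change (Z.neg (Pos.of_succ_nat N)) with (- Z.of_nat (S N))%Z.
    change (Z.pos (Pos.of_succ_nat N)) with (Z.of_nat (S N))%Z.
    rewrite !E; [|rewrite EN; apply Rabs_pos_eq; lra
                 |rewrite opp_IZR, Rabs_Ropp, EN; apply Rabs_pos_eq; lra].
    assert (H := zweight_telescope _ Ha). rewrite S_INR.
    unfold Rdiv in *. lra.
Qed.

(** [qnorm k ^ 6] is [|k|^3], and [|k|] dominates both coordinates as well as 1. The product form
    lets the planar sum factor. *)
Lemma inv_qnorm6_le k : wv_is0 k = false ->
  / qnorm k ^ 6 <= zweight (fst k) * zweight (snd k).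
Proof.
  intros Hk. assert (H1 := knorm_ge1 k Hk). assert (Hs := knorm_sq k).
  assert (Hq : forall x, IZR x ^ 2 <= knormsq k ->
     0 < sqrt (Rmax 1 (Rabs (IZR x))) <= qnorm k).
  { intros x Hx. split.
    - apply sqrt_lt_R0. assert (H := Rmax_l 1 (Rabs (IZR x))). lra.
    - apply sqrt_le_1_alt, Rmax_lub; [assumption|].
      apply le_of_sq_le; [lra|]. rewrite pow2_abs. lra. }
  destruct (Hq (fst k)) as [P1 Q1]; [unfold knormsq; nra|].
  destruct (Hq (snd k)) as [P2 Q2]; [unfold knormsq; nra|].
  unfold zweight. rewrite <- Rinv_mult.
  apply Rinv_le_contravar.
  - apply Rmult_lt_0_compat; now apply pow_lt.
  - replace (qnorm k ^ 6) with (qnorm k ^ 3 * qnorm k ^ 3) by ring.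
    apply Rmult_le_compat; try (apply pow_le; lra); apply pow_incr; lra.
Qed.

(** The ball is enlarged to a box, where the sum is the square of a one-dimensional sum bounded by
    9. *)
Lemma sum_inv_qnorm6 n : sumR (punctured_ball n) (fun k => / qnorm k ^ 6) <= 81.
Proof.
  eapply Rle_trans.
  { apply sumR_le. intros k Hk. apply inv_qnorm6_le. now apply In_punctured_ball in Hk. }
  apply Rle_trans with (sumR (box n) (fun k => zweight (fst k) * zweight (snd k))).
  { apply sumR_le_support.
    - apply NoDup_punctured_ball.
    - apply NoDup_box.
    - intros k. assert (H1 := zweight_pos (fst k)). assert (H2 := zweight_pos (snd k)). nra.
    - intros k Hk _. now apply In_punctured_ball_box. }
  unfold box. rewrite sumR_list_prod.
  assert (H := sumZ_zweight n).
  assert (H0 : 0 <= sumZ (zrange n) zweight)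
    by (apply sumZ_nonneg; intros x; assert (H1 := zweight_pos x); lra).
  assert (0 <= 8 / sqrt (INR n + 1)).
  { apply Rdiv_le_0_compat; [lra|]. apply sqrt_lt_R0. assert (H1 := pos_INR n). lra. }
  nra.
Qed.

(** * Conservation of enstrophy *)

Definition hdot (a b : C2) : C :=
  Cplus (Cmult (fst a) (Cconj (fst b))) (Cmult (snd a) (Cconj (snd b))).

(** The Euclidean inner product of [C^2] seen as a four-dimensional real space; it governs the
    derivative of [|u_k|^2]. *)
Definition rdot (a b : C2) : R := fst (hdot a b).

(* [Re (-i z) = Im z] turns the nonlinear term into an imaginary part. *)
Definition triad (u : state) (k p : wv) : R :=
  snd (Cmult (dotk (u p) k) (hdot (u (wv_sub k p)) (u k))).

Lemma Cmod_sq (z : C) : Cmod z ^ 2 = fst z ^ 2 + snd z ^ 2.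
Proof. unfold Cmod. apply pow2_sqrt. nra. Qed.

Lemma v_norm_sq a : v_norm a ^ 2 = rdot a a.
Proof.
  unfold v_norm. rewrite pow2_sqrt, !Cmod_sq.
  - destruct a as [[a b] [c d]]; unfold rdot, hdot; simpl; ring.
  - assert (H1 := pow2_ge_0 (Cmod (fst a))). assert (H2 := pow2_ge_0 (Cmod (snd a))). lra.
Qed.

Lemma v_norm_nonneg a : 0 <= v_norm a.
Proof. apply sqrt_pos. Qed.

Lemma v_norm_zero : v_norm C2zero = 0.
Proof.
  assert (H := v_norm_sq C2zero). unfold rdot, hdot in H; simpl in H.
  assert (H1 := v_norm_nonneg C2zero). nra.
Qed.

Lemma Cmod_hdot_le a b : Cmod (hdot a b) <= v_norm a * v_norm b.
Proof.
  apply le_of_sq_le; [apply Rmult_le_pos; apply v_norm_nonneg|].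
  rewrite Rpow_mult_distr, !v_norm_sq, Cmod_sq.
  destruct a as [[a1 a2] [a3 a4]], b as [[b1 b2] [b3 b4]].
  unfold rdot, hdot; simpl.
  (* Lagrange's identity: the difference is [|a_1 b_2 - a_2 b_1|^2]. *)
  assert (H1 := pow2_ge_0 (a1 * b3 - a2 * b4 - (a3 * b1 - a4 * b2))).
  assert (H2 := pow2_ge_0 (a1 * b4 + a2 * b3 - (a3 * b2 + a4 * b1))).
  lra.
Qed.

Lemma rdot_le a b : rdot a b <= v_norm a * v_norm b.
Proof.
  eapply Rle_trans; [|apply Cmod_hdot_le].
  eapply Rle_trans; [apply Rle_abs|].
  apply Rle_trans with (1 := Rmax_l _ _) (2 := Rmax_Cmod _).
Qed.

Lemma Cmod_dotk_le a k : Cmod (dotk a k) <= v_norm a * knorm k.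
Proof.
  apply le_of_sq_le; [apply Rmult_le_pos; [apply v_norm_nonneg|apply knorm_nonneg]|].
  rewrite Rpow_mult_distr, v_norm_sq, knorm_sq, Cmod_sq.
  destruct a as [[a1 a2] [a3 a4]]. unfold rdot, hdot, dotk, knormsq; simpl.
  set (x := IZR (fst k)). set (y := IZR (snd k)).
  assert (H1 := pow2_ge_0 (a1 * y - a3 * x)).
  assert (H2 := pow2_ge_0 (a2 * y - a4 * x)).
  lra.
Qed.

Lemma Rabs_triad_le u k p :
  Rabs (triad u k p) <= knorm k * v_norm (u k) * (v_norm (u p) * v_norm (u (wv_sub k p))).
Proof.
  eapply Rle_trans.
  { apply Rle_trans with (1 := Rmax_r _ _) (2 := Rmax_Cmod _). }
  rewrite Cmod_mult.
  assert (H1 := Cmod_dotk_le (u p) k).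
  assert (H2 := Cmod_hdot_le (u (wv_sub k p)) (u k)).
  eapply Rle_trans; [apply Rmult_le_compat; eauto using Cmod_ge_0|].
  right; ring.
Qed.

(* [c] is the coefficient of [(a, b)] on the rotated wave vector [(-y, x)]. *)
Lemma perp_coefficient x y a b (c := (x * b - y * a) * / (x ^ 2 + y ^ 2)) :
  x ^ 2 + y ^ 2 <> 0 -> a * x + b * y = 0 -> a = - y * c /\ b = x * c.
Proof.
  intros H E. unfold c.
  split; apply Rmult_eq_reg_r with (x ^ 2 + y ^ 2); auto.
  - transitivity (- y * (x * b - y * a)); [|field; auto].
    transitivity (- y * (x * b - y * a) + x * (a * x + b * y)); [ring|rewrite E; ring].
  - transitivity (x * (x * b - y * a)); [|field; auto].
    transitivity (x * (x * b - y * a) + y * (a * x + b * y)); [ring|rewrite E; ring].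
Qed.

(* Incompressibility in two dimensions: [u_k] is a multiple of [k] rotated by a right angle. *)
Lemma exists_stream n u : inPnH'0 n u ->
  exists al : wv -> C,
    (forall k, u k = (Cmult (RtoC (- IZR (snd k))) (al k), Cmult (RtoC (IZR (fst k))) (al k))) /\
    (forall k, al (wv_neg k) = Copp (Cconj (al k))) /\
    (forall k, ~ In k (punctured_ball n) -> al k = RtoC 0).
Proof.
  intros [[[_ [Hr Hd]] H0] Hs].
  (* The coefficient of [u_k] on [(-k_2, k_1)]. It is set to 0 at [k = 0] because the origin lies
     outside the punctured ball. *)
  exists (fun k => if wv_is0 k then RtoC 0 else
    Cmult (Cminus (Cmult (RtoC (IZR (fst k))) (snd (u k)))
                  (Cmult (RtoC (IZR (snd k))) (fst (u k)))) (RtoC (/ knormsq k))).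
  split; [|split]; intros k.
  - destruct (wv_is0 k) eqn:Hk.
    + apply wv_is0_true in Hk as ->. rewrite H0. unfold C2zero. now rewrite !Cmult_0_r.
    + assert (Hn := knormsq_ge1 k Hk). specialize (Hd k).
      destruct (u k) as [[a1 a2] [b1 b2]]. unfold knormsq in *.
      unfold dotk in Hd; simpl in Hd. injection Hd as Hd1 Hd2.
      set (x := IZR (fst k)) in *. set (y := IZR (snd k)) in *.
      destruct (perp_coefficient x y a1 b1) as [E1 E2]; [lra|lra|].
      destruct (perp_coefficient x y a2 b2) as [E3 E4]; [lra|lra|].
      apply injective_projections; apply injective_projections; simpl;
        [rewrite E1 at 1|rewrite E3 at 1|rewrite E2 at 1|rewrite E4 at 1]; simpl; ring.
  - assert (E : wv_is0 (wv_neg k) = wv_is0 k).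
    { destruct (wv_is0 k) eqn:Hk.
      - apply wv_is0_true in Hk as ->. reflexivity.
      - destruct (wv_is0 (wv_neg k)) eqn:Hk'; [|reflexivity].
        apply wv_is0_true in Hk'. rewrite <- Hk. symmetry. apply wv_is0_true.
        destruct k as [x y]. unfold wv_neg in Hk'. simpl in Hk'. injection Hk' as E1 E2.
        f_equal; lia. }
    rewrite E. destruct (wv_is0 k).
    + apply injective_projections; simpl; ring.
    + rewrite Hr. unfold knormsq, wv_neg, v_conj; simpl. rewrite !opp_IZR.
      replace (- IZR (fst k) * (- IZR (fst k) * 1) + - IZR (snd k) * (- IZR (snd k) * 1))
        with (IZR (fst k) * (IZR (fst k) * 1) + IZR (snd k) * (IZR (snd k) * 1)) by ring.
      apply injective_projections; simpl; ring.
  - intros Hk. destruct (wv_is0 k) eqn:Ek; [reflexivity|].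
    rewrite (Hs k).
    + unfold C2zero; simpl. rewrite !Cmult_0_r. unfold Cminus.
      apply injective_projections; simpl; ring.
    + apply Bool.not_true_is_false. intros E. apply Hk. now apply In_punctured_ball.
Qed.

(* With [al] the stream function, [triad u k p = J(p,k) (k-p|k) a(k,p)], where
   [a(k,p) = Im (al_p al_(k-p) conj(al_k))] is invariant under the reflections [p -> k - p]
   and [k -> p - k] while [J] changes sign.  As [2(k-p|k) = |k|^2 + |k-p|^2 - |p|^2], the first
   reflection reduces the weight [|k|^2 (k-p|k)] to [|k|^2 |k-p|^2], which the second kills. *)
Lemma enstrophy_conserved n u : inPnH'0 n u ->
  sumR (punctured_ball n)
    (fun k => knormsq k * sumR (punctured_ball n) (triad u k)) = 0.
Proof.
  intros Hu. destruct (exists_stream n u Hu) as (al & Hal & Hc & Hs).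
  set (a := fun k p : wv => snd (Cmult (Cmult (al p) (al (wv_sub k p))) (Cconj (al k)))).
  set (J := fun p k : wv => IZR (fst p) * IZR (snd k) - IZR (snd p) * IZR (fst k)).
  assert (Ht : forall k p, triad u k p =
    J p k * a k p * ((knormsq k + knormsq (wv_sub k p) - knormsq p) / 2)).
  { intros k p. unfold triad, hdot, dotk. rewrite !Hal. unfold J, a, knormsq, wv_sub; simpl.
    rewrite !minus_IZR.
    destruct (al p) as [p1 p2], (al (fst k - fst p, snd k - snd p)%Z) as [q1 q2],
      (al k) as [k1 k2]; simpl. field. }
  assert (Hsub : forall k p, wv_sub k (wv_sub k p) = p).
  { intros k [x y]. unfold wv_sub; simpl. f_equal; lia. }
  assert (Hneg : forall k p, wv_sub p k = wv_neg (wv_sub k p)).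
  { intros k p. unfold wv_sub, wv_neg; simpl. f_equal; lia. }
  assert (Hnorm : forall k, knormsq (wv_neg k) = knormsq k).
  { intros k. unfold knormsq, wv_neg; simpl. rewrite !opp_IZR. ring. }
  assert (Ha0 : forall k p, al k = RtoC 0 \/ al p = RtoC 0 -> a k p = 0).
  { intros k p [E|E]; unfold a; rewrite E; simpl; ring. }
  assert (Hin : forall k, al k <> RtoC 0 -> In k (punctured_ball n)).
  { intros k Hk. destruct (in_dec wv_eq_dec k (punctured_ball n)); [assumption|].
    now destruct Hk; apply Hs. }
  assert (Hdec : forall z : C, z = RtoC 0 \/ z <> RtoC 0).
  { intros z. destruct (Ceq_dec z (RtoC 0)); auto. }
  assert (Hsym1 : forall k p, a k (wv_sub k p) = a k p).
  { intros k p. unfold a. rewrite Hsub. simpl; ring. }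
  assert (Hsym2 : forall k p, a (wv_sub p k) p = a k p).
  { intros k p. unfold a.
    replace (wv_sub (wv_sub p k) p) with (wv_neg k)
      by (unfold wv_sub, wv_neg; simpl; f_equal; lia).
    rewrite (Hneg k p), !Hc. simpl; ring. }
  assert (HJ1 : forall k p, J (wv_sub k p) k = - J p k).
  { intros k p. unfold J, wv_sub; simpl. rewrite !minus_IZR. ring. }
  assert (HJ2 : forall k p, J p (wv_sub p k) = - J p k).
  { intros k p. unfold J, wv_sub; simpl. rewrite !minus_IZR. ring. }
  transitivity (sumR (punctured_ball n) (fun k => sumR (punctured_ball n)
     (fun p => J p k * a k p * (knormsq k * knormsq (wv_sub k p))))).
  { apply sumR_ext. intros k _. rewrite <- sumR_scal. apply Rminus_diag_uniq.
    unfold Rminus. rewrite <- sumR_opp, <- sumR_plus.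
    (* The difference carries the weight [|k|^2 (|k|^2 - |k-p|^2 - |p|^2) / 2], symmetric under
       [p -> k - p], while [J] changes sign. *)
    apply (sumR_antisym (wv_sub k)).
    - apply Hsub.
    - apply NoDup_punctured_ball.
    - intros p. rewrite !Ht, Hsym1, HJ1, Hsub. field.
    - intros p Hp. apply Hin. intros E. apply Hp. rewrite Ht, Ha0; auto. ring. }
  (* Now [p] is fixed: [k -> p - k] exchanges [|k|] and [|k-p|], so only the sign of [J] changes. *)
  rewrite sumR_exchange. apply sumR_0. intros p _.
  apply (sumR_antisym (wv_sub p)).
  - apply Hsub.
  - apply NoDup_punctured_ball.
  - intros k. rewrite Hsym2, HJ2.
    replace (wv_sub (wv_sub p k) p) with (wv_neg k)
      by (unfold wv_sub, wv_neg; simpl; f_equal; lia).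
    rewrite (Hneg k p), !Hnorm. ring.
  - intros k Hk. apply Hin. intros E. apply Hk. rewrite Ha0; auto. ring.
Qed.

(** * The Galerkin equations in real form *)

Lemma rdot_plus a b c : rdot (v_add a b) c = rdot a c + rdot b c.
Proof.
  destruct a as [[? ?] [? ?]], b as [[? ?] [? ?]], c as [[? ?] [? ?]].
  unfold rdot, hdot; simpl; ring.
Qed.

(** [Pi k] subtracts a multiple of [k], which is orthogonal to [b]; hence the projections disappear
    when the equation is tested against [u_k]. *)
Lemma hdot_Pi a b k : dotk b k = RtoC 0 -> hdot (Pi k a) b = hdot a b.
Proof.
  intros H. unfold Pi. set (c := Copp _).
  destruct c as [c1 c2], a as [[a1 a2] [a3 a4]], b as [[b1 b2] [b3 b4]].
  unfold dotk in H; simpl in H. injection H as H1 H2.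
  set (x := IZR (fst k)) in *. set (y := IZR (snd k)) in *.
  assert (E1 : b1 * x + b3 * y = 0) by lra. assert (E2 : b2 * x + b4 * y = 0) by lra.
  unfold hdot; apply injective_projections; simpl; fold x y; apply Rminus_diag_uniq;
    ring_simplify.
  - transitivity (c1 * (b1 * x + b3 * y) + c2 * (b2 * x + b4 * y)); [ring|].
    rewrite E1, E2; ring.
  - transitivity (c2 * (b1 * x + b3 * y) - c1 * (b2 * x + b4 * y)); [ring|].
    rewrite E1, E2; ring.
Qed.

Lemma rdot_galerkin_rhs n nu f t u k : dotk (u k) k = RtoC 0 ->
  rdot (galerkin_rhs n nu f t u k) (u k) =
  sumR (punctured_ball n) (triad u k) - nu * knormsq k * v_norm (u k) ^ 2 + rdot (f t k) (u k).
Proof.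
  intros H. unfold galerkin_rhs. rewrite !rdot_plus.
  unfold rdot at 3. rewrite hdot_Pi by assumption. fold (rdot (f t k) (u k)).
  rewrite v_norm_sq.
  replace (rdot (v_scal (RtoC (- nu * knormsq k)) (u k)) (u k))
    with (- nu * knormsq k * rdot (u k) (u k)).
  2:{ destruct (u k) as [[? ?] [? ?]]. unfold rdot, hdot; simpl; ring. }
  fold (punctured_ball n).
  replace (rdot (v_scal (Copp Ci) _) (u k)) with (sumR (punctured_ball n) (triad u k)); [ring|].
  induction (punctured_ball n) as [|p l IH]; simpl.
  - destruct (u k) as [[? ?] [? ?]]. unfold rdot, hdot; simpl; ring.
  - rewrite IH. unfold triad. rewrite <- (hdot_Pi (u (wv_sub k p)) _ k) by assumption.
    destruct (sumC2 l _) as [[? ?] [? ?]], (u k) as [[? ?] [? ?]],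
      (Pi k (u (wv_sub k p))) as [[? ?] [? ?]], (dotk (u p) k) as [? ?].
    unfold rdot, hdot; simpl; ring.
Qed.

Lemma is_derive_fst (g : R -> C) t l : is_derive g t l -> is_derive (fun s => fst (g s)) t (fst l).
Proof.
  intros H. unfold is_derive in *.
  apply (filterdiff_comp' g fst _ _ _ H (filterdiff_linear _ is_linear_fst)).
Qed.

Lemma is_derive_snd (g : R -> C) t l : is_derive g t l -> is_derive (fun s => snd (g s)) t (snd l).
Proof.
  intros H. unfold is_derive in *.
  apply (filterdiff_comp' g snd _ _ _ H (filterdiff_linear _ is_linear_snd)).
Qed.

Lemma is_derive_v_norm_sq (g : R -> C2) t (l : C2) :
  is_derive (fun s => fst (g s)) t (fst l) -> is_derive (fun s => snd (g s)) t (snd l) ->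
  is_derive (fun s => v_norm (g s) ^ 2) t (2 * rdot l (g t)).
Proof.
  intros H1 H2.
  apply (is_derive_ext (fun s => fst (fst (g s)) ^ 2 + snd (fst (g s)) ^ 2 +
                                 (fst (snd (g s)) ^ 2 + snd (snd (g s)) ^ 2))).
  { intros s. rewrite v_norm_sq. destruct (g s) as [[? ?] [? ?]].
    unfold rdot, hdot; simpl; ring. }
  assert (D1 := is_derive_fst _ _ _ H1). assert (D2 := is_derive_snd _ _ _ H1).
  assert (D3 := is_derive_fst _ _ _ H2). assert (D4 := is_derive_snd _ _ _ H2).
  simpl in *.
  assert (P : forall h (x dx : R), is_derive h x dx ->
     is_derive (fun s : R => h s ^ 2) x (2 * (dx * h x))).
  { intros h x dx Hh. evar_last; [apply (is_derive_pow _ 2 _ _ Hh)|simpl; ring]. }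
  evar_last.
  { apply @is_derive_plus; apply @is_derive_plus; apply P; eassumption. }
  unfold rdot, hdot, plus; simpl; ring.
Qed.

(** * Trajectories for large times *)

(** The threshold time is left unspecified: it may depend on the trajectory and on the projection,
    whereas the constants inside [P] must not. *)
Definition for_large_times (P : R -> Prop) : Prop := Rbar_locally p_infty P.

Lemma for_large_times_imp (P Q : R -> Prop) :
  (forall t, P t -> Q t) -> for_large_times P -> for_large_times Q.
Proof. intros H [M HM]. exists M. auto. Qed.

Lemma for_large_times_and (P Q : R -> Prop) :
  for_large_times P -> for_large_times Q -> for_large_times (fun t => P t /\ Q t).
Proof.
  intros [M HM] [N HN]. exists (Rmax M N). intros t Ht.
  assert (H1 := Rmax_l M N). assert (H2 := Rmax_r M N).
  split; [apply HM|apply HN]; lra.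
Qed.

(** A Galerkin projection has finitely many modes, so thresholds depending on the mode have a common
    upper bound. *)
Lemma for_large_times_list (P : R -> wv -> Prop) l :
  (forall k, In k l -> for_large_times (fun t => P t k)) ->
  for_large_times (fun t => forall k, In k l -> P t k).
Proof.
  induction l as [|a l IH]; intros H.
  - exists 0. intros t _ k [].
  - apply for_large_times_imp with (P := fun t => P t a /\ forall k, In k l -> P t k).
    + intros t [H1 H2] k [<-|Hk]; auto.
    + apply for_large_times_and; [|apply IH]; intros; apply H; simpl; auto.
Qed.

(** The integrating factor [exp (a * s)] makes [exp (a * s) * (w s - b / a)] nonincreasing. The
    excess over [b / a] decays exponentially, and [eps] allows it to be beaten in finite time. *)
Lemma gronwall_for_large_times (w dw : R -> R) (a b eps : R) : 0 < a -> 0 < eps ->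
  for_large_times (fun t => is_derive w t (dw t) /\ dw t <= - a * w t + b) ->
  for_large_times (fun t => w t <= b / a + eps).
Proof.
  intros Ha He [M HM]. set (T := M + 1). set (K := Rabs (w T - b / a)).
  (* After this time [exp (a * (t - T))], being at least [1 + a * (t - T)], exceeds [K / eps], where
     [K] bounds the initial excess. *)
  exists (T + K / (eps * a)). intros t Ht.
  assert (HK : 0 <= K) by apply Rabs_pos.
  assert (0 <= K / (eps * a)) by (apply Rdiv_le_0_compat; nra).
  set (phi := fun s => exp (a * s) * (w s - b / a)).
  assert (Hphi : forall s, M < s ->
    is_derive phi s (exp (a * s) * (dw s - (- a * w s + b)))).
  { intros s Hs. destruct (HM s Hs) as [D _]. unfold phi.
    auto_derive; [exists (dw s); exact D|].
    replace (Derive (fun x => w x) s) with (dw s) by (symmetry; now apply is_derive_unique).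
    field. lra. }
  destruct (MVT_gen phi T t (fun s => exp (a * s) * (dw s - (- a * w s + b))))
    as (c & Hc & E); rewrite ?Rmin_left, ?Rmax_right in * by (unfold T in *; lra).
  { intros s Hs. apply Hphi. unfold T in *; lra. }
  { intros s Hs. apply continuity_pt_filterlim, @ex_derive_continuous.
    eexists. apply Hphi. unfold T in *; lra. }
  destruct (HM c) as [_ Hdw]; [unfold T in *; lra|].
  assert (Hdec : phi t <= phi T).
  { assert (P := exp_pos (a * c)).
    assert (exp (a * c) * (dw c - (- a * w c + b)) * (t - T) <= 0); [|lra].
    assert (0 <= exp (a * c) * (- a * w c + b - dw c)) by (apply Rmult_le_pos; lra).
    nra. }
  assert (Hexp : K <= eps * exp (a * (t - T))).
  { assert (1 + a * (t - T) <= exp (a * (t - T))) by apply exp_ineq1_le.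
    assert (K <= eps * (a * (t - T))); [|nra].
    replace K with (K / (eps * a) * (eps * a)) by (field; lra).
    assert (0 < eps * a) by nra. nra. }
  unfold phi in Hdec. replace (a * t) with (a * T + a * (t - T)) in Hdec by ring.
  rewrite exp_plus, Rmult_assoc in Hdec.
  apply Rmult_le_reg_l in Hdec; [|apply exp_pos].
  assert (w T - b / a <= K) by apply Rle_abs.
  assert (P := exp_pos (a * (t - T))).
  destruct (Rle_lt_dec (w t) (b / a + eps)); [assumption|nra].
Qed.

Lemma is_derive_sumR l (g : R -> wv -> R) (dg : wv -> R) t :
  (forall k, In k l -> is_derive (fun s => g s k) t (dg k)) ->
  is_derive (fun s => sumR l (g s)) t (sumR l dg).
Proof.
  induction l as [|a l IH]; simpl; intros H.
  - apply @is_derive_const.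
  - apply @is_derive_plus; auto.
Qed.

Lemma traj_mode_derive n nu f t0 u : galerkin_traj n nu f t0 u ->
  forall t k, t0 < t -> In k (punctured_ball n) ->
  is_derive (fun s => v_norm (u s k) ^ 2) t
    (2 * (sumR (punctured_ball n) (triad (u t) k) - nu * knormsq k * v_norm (u t k) ^ 2
          + rdot (f t k) (u t k))).
Proof.
  intros Hu t k Ht Hk. destruct (Hu t Ht) as [[[[_ [_ Hd]] _] _] HD].
  apply In_punctured_ball in Hk. destruct Hk as [Hk1 Hk2].
  destruct (HD k Hk1 Hk2) as [D1 D2].
  rewrite <- rdot_galerkin_rhs by apply Hd.
  now apply is_derive_v_norm_sq.
Qed.

Lemma inPnH'0_support n u k : inPnH'0 n u -> ~ In k (punctured_ball n) -> u k = C2zero.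
Proof.
  intros [[_ H0] Hs] Hk. destruct (wv_is0 k) eqn:E.
  - now apply wv_is0_true in E as ->.
  - apply Hs. apply Bool.not_true_is_false. intros E'. apply Hk. now apply In_punctured_ball.
Qed.

(** * Enstrophy *)

Lemma enstrophy_term_nonneg (u : state) k : 0 <= knormsq k * v_norm (u k) ^ 2.
Proof. apply Rmult_le_pos; [apply knormsq_nonneg|apply pow2_ge_0]. Qed.

(** The boxes are nested, so the partial sums increase to their limit, finite or not. *)
Lemma sumR_box_le_Venst u N :
  Rbar_le (sumR (box N) (fun k => knormsq k * v_norm (u k) ^ 2)) (Venst u).
Proof.
  unfold Venst. rewrite <- Lim_seq_const. apply Lim_seq_le_loc. exists N.
  intros n Hn. induction Hn as [|n Hn IH]; [lra|].
  eapply Rle_trans; [exact IH|].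
  apply sumR_le_support; auto using NoDup_box, enstrophy_term_nonneg, In_box_mono.
Qed.

(** A real number that can be differentiated, unlike the [Rbar]-valued [Venst]; the two agree on
    [inPnH'0 n]. *)
Definition galerkin_enstrophy (n : nat) (u : state) : R :=
  sumR (punctured_ball n) (fun k => knormsq k * v_norm (u k) ^ 2).

Lemma galerkin_enstrophy_le_Venst n u : Rbar_le (galerkin_enstrophy n u) (Venst u).
Proof.
  eapply Rbar_le_trans; [|apply (sumR_box_le_Venst u n)]. cbn [Rbar_le].
  apply sumR_le_support; auto using NoDup_box, NoDup_punctured_ball, enstrophy_term_nonneg,
    In_punctured_ball_box.
Qed.

Lemma Venst_le_galerkin_enstrophy n u : inPnH'0 n u ->
  Rbar_le (Venst u) (galerkin_enstrophy n u).
Proof.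
  intros Hu. unfold Venst. rewrite <- (Lim_seq_const (galerkin_enstrophy n u)).
  apply Lim_seq_le_loc. exists 0%nat. intros N _.
  apply sumR_le_support; auto using NoDup_box, NoDup_punctured_ball, enstrophy_term_nonneg.
  intros k _ Hk. destruct (in_dec wv_eq_dec k (punctured_ball n)) as [|Hn]; [assumption|].
  destruct Hk. rewrite (inPnH'0_support n u k Hu Hn), v_norm_zero. ring.
Qed.

(** The supremum is an extended real. It cannot be [p_infty], whose product with [/ nu ^ 2] is not
    below [V0], nor [m_infty], as it bounds real enstrophies; the remaining finite value is [B]. *)
Lemma Vstar_lt_bound nu f V0 : 0 < nu -> Rbar_lt (Vstar nu f) (Finite V0) ->
  exists B, 0 <= B /\ B / nu ^ 2 < V0 /\ forall t n, galerkin_enstrophy n (f t) <= B.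
Proof.
  intros Hnu H. unfold Vstar, Rbar_lub in H.
  destruct (Rbar_ex_lub _) as [l [Hub Hlub]]. cbn [proj1_sig] in H. clear Hlub.
  assert (Hp : 0 < / nu ^ 2) by (apply Rinv_0_lt_compat, pow_lt, Hnu).
  assert (Hl : forall t n, Rbar_le (galerkin_enstrophy n (f t)) l).
  { intros t n. eapply Rbar_le_trans; [apply galerkin_enstrophy_le_Venst|].
    apply Hub. now exists t. }
  destruct l as [B| |].
  - exists B. repeat split; [|simpl in H; unfold Rdiv; simpl; lra|exact Hl].
    eapply Rle_trans; [|apply (Hl 0 0%nat)]. apply sumR_nonneg. auto using enstrophy_term_nonneg.
  - exfalso. replace (Rbar_mult (/ nu ^ 2) p_infty) with p_infty in H; [exact H|].
    symmetry. apply is_Rbar_mult_unique.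
    apply (is_Rbar_mult_sym p_infty), is_Rbar_mult_p_infty_pos. exact Hp.
  - destruct (Hl 0 0%nat).
Qed.

Lemma enstrophy_for_large_times nu f V0 B n t0 u : 0 < nu -> B / nu ^ 2 < V0 ->
  (forall t, galerkin_enstrophy n (f t) <= B) -> galerkin_traj n nu f t0 u ->
  for_large_times (fun t => galerkin_enstrophy n (u t) <= V0).
Proof.
  intros Hnu HB Hf Hu.
  set (rate := fun t k => knormsq k * (2 * (sumR (punctured_ball n) (triad (u t) k)
     - nu * knormsq k * v_norm (u t k) ^ 2 + rdot (f t k) (u t k)))).
  (* Gronwall is applied with rate [nu] and source [B / nu]; the gap [V0 - B / nu ^ 2] plays the
     role of [eps]. *)
  apply for_large_times_imp
    with (P := fun t => galerkin_enstrophy n (u t) <= B / nu / nu + (V0 - B / nu ^ 2)).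
  { intros t H. replace (B / nu ^ 2) with (B / nu / nu) in H by (field; lra). lra. }
  apply (gronwall_for_large_times _ (fun t => sumR (punctured_ball n) (rate t)));
    [assumption|lra|].
  exists t0. intros t Ht. split.
  { apply is_derive_sumR. intros k Hk. unfold rate.
    apply (is_derive_scal (fun s => v_norm (u s k) ^ 2)).
    now apply (traj_mode_derive n nu f t0 u). }
  (* Young's inequality pays for the forcing with half of the dissipation, and [|k| >= 1] turns the
     other half into damping at rate [nu]. *)
  assert (Hdiss : forall k, In k (punctured_ball n) -> rate t k <=
     2 * (knormsq k * sumR (punctured_ball n) (triad (u t) k))
     + (- nu * (knormsq k * v_norm (u t k) ^ 2) + / nu * (knormsq k * v_norm (f t k) ^ 2))).
  { intros k Hk. unfold rate. apply In_punctured_ball in Hk. destruct Hk as [_ Hk].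
    apply knormsq_ge1 in Hk.
    assert (Hr := rdot_le (f t k) (u t k)).
    set (x := v_norm (f t k)) in *. set (y := v_norm (u t k)) in *.
    set (r := rdot _ _) in *. set (S := sumR _ _).
    assert (Hxy : 2 * (x * y) <= nu * y ^ 2 + / nu * x ^ 2).
    { assert (0 <= nu * (y - / nu * x) ^ 2) by (apply Rmult_le_pos; [lra|apply pow2_ge_0]).
      replace (nu * (y - / nu * x) ^ 2) with (nu * y ^ 2 + / nu * x ^ 2 - 2 * (x * y)) in H
        by (field; lra). lra. }
    assert (Hy : nu * y ^ 2 <= nu * knormsq k * y ^ 2).
    { assert (0 <= nu * y ^ 2) by (apply Rmult_le_pos; [lra|apply pow2_ge_0]). nra. }
    replace (2 * (knormsq k * S)
      + (- nu * (knormsq k * y ^ 2) + / nu * (knormsq k * x ^ 2)))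
      with (knormsq k * (2 * S - nu * y ^ 2 + / nu * x ^ 2)) by ring.
    apply Rmult_le_compat_l; lra. }
  eapply Rle_trans; [apply sumR_le, Hdiss|].
  rewrite sumR_plus, sumR_plus, !sumR_scal.
  rewrite (enstrophy_conserved n (u t)) by now apply Hu.
  fold (galerkin_enstrophy n (u t)). fold (galerkin_enstrophy n (f t)).
  assert (/ nu * galerkin_enstrophy n (f t) <= / nu * B).
  { apply Rmult_le_compat_l; [left; now apply Rinv_0_lt_compat|apply Hf]. }
  unfold Rdiv. lra.
Qed.

(** * Bootstrap of the decay of the Fourier coefficients *)

(** Each term is the product of [q^2 |u_k|] and [q^(-3)], bounded by half the sum of their squares;
    the squares sum to the enstrophy and the lattice sum. *)
Lemma sum_norm_div_qnorm_le n u :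
  sumR (punctured_ball n) (fun k => v_norm (u k) / qnorm k) <=
  / 2 * (galerkin_enstrophy n u + 81).
Proof.
  eapply Rle_trans with (/ 2 * (galerkin_enstrophy n u
    + sumR (punctured_ball n) (fun k => / qnorm k ^ 6))).
  - unfold galerkin_enstrophy. rewrite <- sumR_plus, <- sumR_scal.
    apply sumR_le. intros k Hk. apply In_punctured_ball in Hk. destruct Hk as [_ Hk].
    apply qnorm_ge1 in Hk. rewrite <- knorm_sq, <- qnorm_sq.
    set (q := qnorm k) in *. set (y := v_norm (u k)).
    assert (H := pow2_ge_0 (q ^ 2 * y - / q ^ 3)).
    replace ((q ^ 2 * y - / q ^ 3) ^ 2)
      with ((q ^ 2) ^ 2 * y ^ 2 + / q ^ 6 - 2 * (y / q)) in H by (field; lra).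
    lra.
  - assert (H := sum_inv_qnorm6 n). lra.
Qed.

(** The triangle inequality gives [|k| <= 2 |p|], hence even the factor [sqrt 2]; 2 is a convenient
    weakening. *)
Lemma qnorm_le_double k p : qnorm (wv_sub k p) <= qnorm p -> qnorm k <= 2 * qnorm p.
Proof.
  intros H. assert (H1 := qnorm_nonneg p). assert (H2 := qnorm_nonneg (wv_sub k p)).
  apply le_of_sq_le; [lra|].
  assert (H3 := knorm_triang k p). rewrite <- !qnorm_sq in H3. nra.
Qed.

(** Here [x] and [y] belong to the longer and the shorter wave vector. Of the [m + 1] powers of
    decay of [a], [m] pay for [q ^ m]; the last is handed over to [b] as [1 / y], which makes the
    sum over [b] controllable. *)
Lemma convolution_term_le q x y a b c m :
  0 <= a -> 0 <= b -> 0 < y <= x -> 0 <= q <= 2 * x -> a * x ^ S m <= c ->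
  q ^ m * (a * b) <= 2 ^ m * c * (b / y).
Proof.
  intros Ha Hb Hy Hq Hc.
  assert (Hx : 0 < x ^ m) by (apply pow_lt; lra).
  assert (H2 : 0 < 2 ^ m) by (apply pow_lt; lra).
  assert (Hqm : q ^ m <= 2 ^ m * x ^ m) by (rewrite <- Rpow_mult_distr; now apply pow_incr).
  assert (Hax : a * x ^ m <= c / y).
  { simpl in Hc. apply Rmult_le_reg_r with y; [lra|].
    replace (c / y * y) with c by (field; lra).
    assert (0 <= a * x ^ m) by (apply Rmult_le_pos; lra). nra. }
  apply Rle_trans with (2 ^ m * (a * x ^ m) * b).
  - replace (2 ^ m * (a * x ^ m) * b) with (2 ^ m * x ^ m * (a * b)) by ring.
    apply Rmult_le_compat_r; [now apply Rmult_le_pos|assumption].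
  - replace (2 ^ m * c * (b / y)) with (2 ^ m * (c / y) * b) by (field; lra).
    apply Rmult_le_compat_r; [assumption|]. apply Rmult_le_compat_l; lra.
Qed.

Lemma convolution_le n u m c k :
  (forall p, ~ In p (punctured_ball n) -> u p = C2zero) -> 0 <= c ->
  (forall p, In p (punctured_ball n) -> v_norm (u p) * qnorm p ^ S m <= c) ->
  qnorm k ^ m * sumR (punctured_ball n) (fun p => v_norm (u p) * v_norm (u (wv_sub k p))) <=
  2 ^ S m * c * sumR (punctured_ball n) (fun p => v_norm (u p) / qnorm p).
Proof.
  intros Hs Hc Hu. set (h := fun p => v_norm (u p) / qnorm p).
  assert (Hp2 : 0 <= 2 ^ m * c) by (apply Rmult_le_pos; [apply pow_le; lra|assumption]).
  assert (Hq0 := qnorm_nonneg k).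
  assert (Hq : forall p, In p (punctured_ball n) -> 1 <= qnorm p).
  { intros p Hp. apply qnorm_ge1. now apply In_punctured_ball in Hp. }
  assert (Hh0 : forall p, ~ In p (punctured_ball n) -> h p = 0).
  { intros p Hp. unfold h. rewrite (Hs p Hp), v_norm_zero. unfold Rdiv. ring. }
  assert (Hh : forall p, 0 <= h p).
  { intros p. destruct (in_dec wv_eq_dec p (punctured_ball n)) as [Hp|Hp].
    - apply Rdiv_le_0_compat; [apply v_norm_nonneg|]. apply Hq in Hp. lra.
    - rewrite Hh0 by assumption. lra. }
  assert (Hterm : forall p, In p (punctured_ball n) ->
    qnorm k ^ m * (v_norm (u p) * v_norm (u (wv_sub k p))) <=
    2 ^ m * c * (h p + h (wv_sub k p))).
  { intros p Hp. assert (H1 := v_norm_nonneg (u p)).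
    assert (H2 := v_norm_nonneg (u (wv_sub k p))).
    destruct (in_dec wv_eq_dec (wv_sub k p) (punctured_ball n)) as [Hj|Hj].
    - assert (P1 := Hq p Hp). assert (P2 := Hq _ Hj).
      rewrite Rmult_plus_distr_l.
      assert (G1 : 0 <= 2 ^ m * c * h p) by (apply Rmult_le_pos; auto).
      assert (G2 : 0 <= 2 ^ m * c * h (wv_sub k p)) by (apply Rmult_le_pos; auto).
      (* The longer of the two wave vectors supplies the decay, the shorter one the weight [h];
         allowing for both cases gives the second factor 2 in [2 ^ S m]. *)
      destruct (Rle_dec (qnorm (wv_sub k p)) (qnorm p)) as [Hle|Hle].
      + assert (H := qnorm_le_double k p Hle).
        assert (T := convolution_term_le (qnorm k) (qnorm p) (qnorm (wv_sub k p))
          (v_norm (u p)) (v_norm (u (wv_sub k p))) c m).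
        unfold h in *. specialize (Hu p Hp). lra.
      + assert (Hkp : wv_sub k (wv_sub k p) = p)
          by (destruct p; unfold wv_sub; simpl; f_equal; lia).
        assert (H := qnorm_le_double k (wv_sub k p)). rewrite Hkp in H.
        assert (T := convolution_term_le (qnorm k) (qnorm (wv_sub k p)) (qnorm p)
          (v_norm (u (wv_sub k p))) (v_norm (u p)) c m).
        rewrite (Rmult_comm (v_norm (u p))).
        unfold h in *. specialize (Hu _ Hj). lra.
    - rewrite (Hs _ Hj), v_norm_zero, Rmult_0_r, Rmult_0_r.
      apply Rmult_le_pos; [assumption|]. specialize (Hh p) as G1.
      specialize (Hh (wv_sub k p)) as G2. lra. }
  (* [p -> k - p] is injective and [h] vanishes off the ball, so reflecting the index cannot
     increase the sum. *)
  assert (Hreflect : sumR (punctured_ball n) (fun p => h (wv_sub k p))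
                     <= sumR (punctured_ball n) h).
  { rewrite <- sumR_map. apply sumR_le_support; auto using NoDup_punctured_ball.
    - apply NoDup_map_NoDup_ForallPairs; [|apply NoDup_punctured_ball].
      intros [x1 y1] [x2 y2] _ _ E. unfold wv_sub in E; simpl in E. injection E as E1 E2.
      f_equal; lia.
    - intros p _ Hp. destruct (in_dec wv_eq_dec p (punctured_ball n)); [assumption|].
      destruct Hp. auto. }
  rewrite <- sumR_scal.
  eapply Rle_trans; [apply sumR_le, Hterm|].
  rewrite sumR_scal, sumR_plus. simpl.
  replace (2 * 2 ^ m * c * sumR (punctured_ball n) h)
    with (2 ^ m * c * (sumR (punctured_ball n) h + sumR (punctured_ball n) h)) by ring.
  apply Rmult_le_compat_l; lra.
Qed.

Lemma forcing_decay f m : forcing_ok f ->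
  exists M, 0 <= M /\ forall t k, wv_is0 k = false -> v_norm (f t k) * qnorm k ^ m <= M.
Proof.
  (* The exponent [m + 1] is positive even for [m = 0], and [|k| >= 1] makes [|k|^(m+1)] dominate
     [qnorm k ^ m]. *)
  intros (_ & _ & H). destruct (H (INR (S m))) as [M HM].
  { apply (lt_INR 0). lia. }
  exists (Rmax M 0). split; [apply Rmax_r|]. intros t k Hk.
  eapply Rle_trans; [|apply Rmax_l]. eapply Rle_trans; [|apply (HM t k Hk)].
  assert (H1 := qnorm_ge1 k Hk). assert (H2 := knorm_ge1 k Hk).
  rewrite Rpower_pow by lra. rewrite Rmult_comm.
  apply Rmult_le_compat_r; [apply v_norm_nonneg|].
  rewrite <- qnorm_sq, <- pow_mult. apply Rle_pow; [assumption|lia].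
Qed.

(** With [q = qnorm k], nonlinear term and forcing have size at most [q^2 D / q^m], where [D] is the
    numerator of the new constant; dividing by the damping rate [nu q^4] leaves [D / nu] over
    [q^(m+2)]. The final [+ 1] absorbs the error in Gronwall's bound. *)
Lemma decay_step nu f n t0 u m c M V0 : 0 < nu -> 0 <= V0 -> 0 <= c -> 0 <= M ->
  (forall t k, wv_is0 k = false -> v_norm (f t k) * qnorm k ^ m <= M) ->
  galerkin_traj n nu f t0 u ->
  for_large_times (fun t => galerkin_enstrophy n (u t) <= V0) ->
  for_large_times (fun t => forall k, In k (punctured_ball n) ->
    v_norm (u t k) * qnorm k ^ S m <= c) ->
  for_large_times (fun t => forall k, In k (punctured_ball n) ->
    v_norm (u t k) * qnorm k ^ S (S m) <= (2 ^ S m * c * (/ 2 * (V0 + 81)) + M) / nu + 1).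
Proof.
  intros Hnu HV0 Hc HM Hf Hu HV Hdec. set (D := 2 ^ S m * c * (/ 2 * (V0 + 81)) + M).
  apply for_large_times_list. intros k Hk.
  assert (Hk0 : wv_is0 k = false) by now apply In_punctured_ball in Hk.
  assert (Hq := qnorm_ge1 k Hk0).
  assert (Hk2 : knorm k = qnorm k ^ 2) by (symmetry; apply qnorm_sq).
  assert (Hk4 : knormsq k = qnorm k ^ 4) by (rewrite <- knorm_sq, Hk2; ring).
  set (q := qnorm k) in *.
  assert (Hqm : forall j, 0 < q ^ j) by (intros j; apply pow_lt; lra).
  set (E := q ^ 2 * D / q ^ m).
  assert (Hrate : for_large_times (fun t =>
    is_derive (fun s => v_norm (u s k) ^ 2) t
      (2 * (sumR (punctured_ball n) (triad (u t) k) - nu * knormsq k * v_norm (u t k) ^ 2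
          + rdot (f t k) (u t k))) /\
    2 * (sumR (punctured_ball n) (triad (u t) k) - nu * knormsq k * v_norm (u t k) ^ 2
          + rdot (f t k) (u t k))
    <= - (nu * q ^ 4) * v_norm (u t k) ^ 2 + E ^ 2 / (nu * q ^ 4))).
  { destruct (for_large_times_and _ _ HV Hdec) as [T HT]. exists (Rmax T t0).
    intros t Ht. assert (H1 := Rmax_l T t0). assert (H2 := Rmax_r T t0).
    destruct (HT t) as [HVt Hdt]; [lra|].
    split; [apply (traj_mode_derive n nu f t0 u); auto; lra|].
    set (X := sumR (punctured_ball n)
      (fun p => v_norm (u t p) * v_norm (u t (wv_sub k p)))).
    assert (HX : q ^ m * X <= 2 ^ S m * c * (/ 2 * (V0 + 81))).
    { eapply Rle_trans; [apply (convolution_le n (u t) m c); auto|].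
      - intros p. apply inPnH'0_support. apply Hu. lra.
      - apply Rmult_le_compat_l.
        + apply Rmult_le_pos; [apply pow_le; lra|assumption].
        + eapply Rle_trans; [apply sum_norm_div_qnorm_le|]. lra. }
    assert (Htri : sumR (punctured_ball n) (triad (u t) k) <= q ^ 2 * v_norm (u t k) * X).
    { unfold X. rewrite <- sumR_scal. eapply Rle_trans; [apply Rle_abs|].
      eapply Rle_trans; [apply Rabs_sumR|]. apply sumR_le. intros p _.
      rewrite <- Hk2. apply Rabs_triad_le. }
    assert (Hr := rdot_le (f t k) (u t k)). specialize (Hf t k Hk0). fold q in Hf.
    assert (Hy := v_norm_nonneg (u t k)). assert (Hx := v_norm_nonneg (f t k)).
    set (y := v_norm (u t k)) in *. set (x := v_norm (f t k)) in *.
    set (r := rdot _ _) in *. set (S1 := sumR _ (triad _ _)) in *.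
    assert (Hsum : q ^ 2 * X + x <= E).
    { unfold E. apply Rmult_le_reg_r with (q ^ m); [apply Hqm|].
      replace (q ^ 2 * D / q ^ m * q ^ m) with (q ^ 2 * D)
        by (field; apply Rgt_not_eq, Hqm).
      assert (1 <= q ^ 2) by nra. unfold D. nra. }
    assert (HSr : S1 + r <= y * E) by nra.
    (* Half of the damping [2 * nu * q ^ 4] is spent here, the other half remains for Gronwall. *)
    assert (Hyoung : 2 * (y * E) <= nu * q ^ 4 * y ^ 2 + E ^ 2 / (nu * q ^ 4)).
    { assert (Ha : 0 < nu * q ^ 4) by (apply Rmult_lt_0_compat; auto).
      assert (H := Rmult_le_pos _ _ (Rlt_le _ _ Ha) (pow2_ge_0 (y - E / (nu * q ^ 4)))).
      replace (nu * q ^ 4 * (y - E / (nu * q ^ 4)) ^ 2)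
        with (nu * q ^ 4 * y ^ 2 + E ^ 2 / (nu * q ^ 4) - 2 * (y * E)) in H
        by (field; split; lra).
      lra. }
    rewrite Hk4. lra. }
  (* This [eps] scales like the square of the target decay, so it adds 1 to [(D / nu) ^ 2], and the
     sum is at most [(D / nu + 1) ^ 2]. *)
  apply gronwall_for_large_times with (eps := / (q ^ S (S m)) ^ 2) in Hrate.
  - revert Hrate. apply for_large_times_imp. intros t Ht.
    assert (Hy := v_norm_nonneg (u t k)).
    assert (HD : 0 <= D / nu).
    { apply Rdiv_le_0_compat; [|assumption]. unfold D.
      assert (0 <= 2 ^ S m * c * (/ 2 * (V0 + 81))); [|lra].
      apply Rmult_le_pos; [apply Rmult_le_pos; [apply pow_le; lra|assumption]|lra]. }
    apply le_of_sq_le; [lra|].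
    assert (HQ := Hqm m). assert (Hq2 := Hqm (S (S m))).
    replace (E ^ 2 / (nu * q ^ 4) / (nu * q ^ 4) + / (q ^ S (S m)) ^ 2)
      with (((D / nu) ^ 2 + 1) * / (q ^ S (S m)) ^ 2) in Ht
      by (unfold E; simpl; field; repeat split; lra).
    rewrite Rpow_mult_distr.
    apply Rle_trans with ((D / nu) ^ 2 + 1); [|nra].
    apply Rmult_le_reg_r with (/ (q ^ S (S m)) ^ 2); [apply Rinv_0_lt_compat, pow_lt, Hq2|].
    replace (v_norm (u t k) ^ 2 * (q ^ S (S m)) ^ 2 * / (q ^ S (S m)) ^ 2)
      with (v_norm (u t k) ^ 2) by (field; lra).
    exact Ht.
  - apply Rmult_lt_0_compat; auto.
  - apply Rinv_0_lt_compat. apply pow_lt, Hqm.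
Qed.

(** Iterates [decay_step]. The constant is chosen before [n], [t0] and [u], so one absorbing set
    serves all projections. *)
Lemma uniform_decay nu f V0 m : 0 < nu -> forcing_ok f ->
  Rbar_lt (Vstar nu f) (Finite V0) ->
  exists c, 0 <= c /\ forall n t0 u, galerkin_traj n nu f t0 u ->
    for_large_times (fun t => forall k, In k (punctured_ball n) ->
      v_norm (u t k) * qnorm k ^ (2 + m) <= c).
Proof.
  intros Hnu Hf HV. destruct (Vstar_lt_bound nu f V0 Hnu HV) as (B & HB0 & HB & HfB).
  assert (HV0 : 0 <= V0).
  { assert (0 <= B / nu ^ 2) by (apply Rdiv_le_0_compat; [|apply pow_lt]; assumption). lra. }
  induction m as [|m (c & Hc & IH)].
  (* At exponent 2 the claim reads [|u_k| |k| <= V0 + 1]; a single enstrophy term gives [sqrt V0],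
     which is smaller. *)
  - exists (V0 + 1). split; [lra|]. intros n t0 u Hu.
    assert (HE := enstrophy_for_large_times nu f V0 B n t0 u Hnu HB (fun t => HfB t n) Hu).
    revert HE. apply for_large_times_imp. intros t Ht k Hk.
    assert (H := sumR_ge_term _ (fun k => knormsq k * v_norm (u t k) ^ 2) k
      (fun k _ => enstrophy_term_nonneg (u t) k) Hk).
    fold (galerkin_enstrophy n (u t)) in H. simpl Nat.add. rewrite qnorm_sq.
    apply le_of_sq_le; [lra|]. rewrite Rpow_mult_distr, knorm_sq. nra.
  - destruct (forcing_decay f (S m) Hf) as (M & HM & HfM).
    exists ((2 ^ S (S m) * c * (/ 2 * (V0 + 81)) + M) / nu + 1). split.
    { assert (0 <= (2 ^ S (S m) * c * (/ 2 * (V0 + 81)) + M) / nu); [|lra].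
      apply Rdiv_le_0_compat; [|assumption].
      assert (0 <= 2 ^ S (S m) * c * (/ 2 * (V0 + 81))); [|lra].
      apply Rmult_le_pos; [apply Rmult_le_pos; [apply pow_le; lra|assumption]|lra]. }
    intros n t0 u Hu.
    (* At index [S m] this step takes exponent [2 + m] to exponent [2 + S m]. *)
    apply (decay_step nu f n t0 u (S m) c M V0); auto.
    + now apply (enstrophy_for_large_times nu f V0 B n t0 u).
    + apply (IH n t0 u Hu).
Qed.

(** * Absorbing sets *)

Lemma W_absorbing nu f V0 s : 0 < nu -> forcing_ok f ->
  Rbar_lt (Vstar nu f) (Finite V0) -> (2 <= s)%nat ->
  exists Cs, 0 <= Cs /\ absorbing_all_galerkin nu f (W V0 s Cs).
Proof.
  intros Hnu Hf HV Hs. destruct (Vstar_lt_bound nu f V0 Hnu HV) as (B & _ & HB & HfB).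
  (* Decay of order [s] in [|k|] is order [2 * s] in [qnorm], and [uniform_decay] counts from 2. *)
  destruct (uniform_decay nu f V0 (2 * s - 2) Hnu Hf HV) as (c & Hc & Hdec).
  exists c. split; [assumption|]. intros n t0 u Hu.
  destruct (for_large_times_and _ _
    (enstrophy_for_large_times nu f V0 B n t0 u Hnu HB (fun t => HfB t n) Hu)
    (Hdec n t0 u Hu)) as [T HT].
  exists (Rmax T t0 + 1). assert (H1 := Rmax_l T t0). assert (H2 := Rmax_r T t0).
  set (t := Rmax T t0 + 1) in *. assert (Ht : t0 < t) by (unfold t; lra).
  destruct (HT t) as [HE Hk]; [unfold t; lra|]. destruct (Hu t Ht) as [HP _].
  split; [assumption|]. split; [apply HP|]. split.
  - eapply Rbar_le_trans; [apply (Venst_le_galerkin_enstrophy n _ HP)|exact HE].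
  - intros k Hk0. assert (Hn := knorm_ge1 k Hk0).
    assert (Hpow : 0 < knorm k ^ s) by (apply pow_lt; lra).
    destruct (in_dec wv_eq_dec k (punctured_ball n)) as [Hin|Hout].
    + specialize (Hk k Hin).
      replace (2 + (2 * s - 2))%nat with (2 * s)%nat in Hk by lia.
      rewrite pow_mult, qnorm_sq in Hk.
      apply Rmult_le_reg_r with (knorm k ^ s); [assumption|].
      replace (c / knorm k ^ s * knorm k ^ s) with c by (field; lra). exact Hk.
    + rewrite (inPnH'0_support n (u t) k HP Hout), v_norm_zero.
      now apply Rdiv_le_0_compat.
Qed.

Theorem mainTheorem3 :
  forall (nu : R) (f : R -> state) (V0 : R),
    0 < nu ->
    forcing_ok f ->
    Rbar_lt (Vstar nu f) (Finite V0) ->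
    (exists (A : nat -> state -> Prop) (Cc : nat -> R),
        (forall i, (2 <= i)%nat -> absorbing_all_galerkin nu f (A i)) /\
        (forall i, (2 <= i)%nat -> forall u, A i u ->
            inH'0 u /\ Rbar_le (Venst u) (Finite V0) /\
            forall k, wv_is0 k = false ->
              v_norm (u k) <= Cc i / Rpower (knorm k) (INR i / 2 + 1))) /\
    (forall s : nat, (2 <= s)%nat ->
        exists Cs : R, absorbing_all_galerkin nu f (W V0 s Cs)).
Proof.
  intros nu f V0 Hnu Hf HV.
  (* The condition [2 <= s] sits under the existential, with dummy constant 0 below 2, so that
     choice yields a function on all of [nat]. *)
  assert (HW : forall s : nat, exists Cs : R, (2 <= s)%nat ->
    0 <= Cs /\ absorbing_all_galerkin nu f (W V0 s Cs)).
  { intros s. destruct (le_dec 2 s) as [Hs|Hs].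
    - destruct (W_absorbing nu f V0 s Hnu Hf HV Hs) as (Cs & H). now exists Cs.
    - exists 0. contradiction. }
  split; [|intros s Hs; destruct (HW s) as (Cs & H); exists Cs; now apply H].
  set (Cc := fun s => proj1_sig (constructive_indefinite_description _ (HW s))).
  assert (HCc : forall s, (2 <= s)%nat ->
    0 <= Cc s /\ absorbing_all_galerkin nu f (W V0 s (Cc s))).
  { intros s. exact (proj2_sig (constructive_indefinite_description _ (HW s))). }
  exists (fun i => W V0 i (Cc i)), Cc.
  split; [intros i Hi; now apply HCc|].
  intros i Hi u (Hu & HVu & Hk). split; [assumption|]. split; [assumption|].
  intros k Hk0. eapply Rle_trans; [now apply Hk|].
  (* [i/2 + 1 <= i] because [2 <= i], and [1 <= |k|] *)
  destruct (HCc i Hi) as [Hc _]. assert (Hn := knorm_ge1 k Hk0).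
  apply Rmult_le_compat_l; [assumption|]. apply Rinv_le_contravar; [apply exp_pos|].
  rewrite <- Rpower_pow by lra.
  apply Rle_Rpower; [assumption|]. apply le_INR in Hi. simpl in Hi. lra.
Qed.
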